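(* Let $n\ge1$, $1\le p<\infty$, $0<\lambda<\frac np$, and $0<q\le\infty$. There are constants $c,C>0$, depending only on $n,p,q,\lambda$, such that for every measurable (locally integrable) function $f$ on $\mathbb R^n$ satisfying $$\lim_{r\to+\infty}\frac1{|B_r|}\int_{B_r(x)}f(y)\,dy=0\qquad\text{for every }x\in\mathbb R^n,$$ one has $$c\,\|f\|_{M_{p,q}^\lambda}\le\|f\|_{C_{p,q}^\lambda}\le C\,\|f\|_{M_{p,q}^\lambda}.$$
   Context: $B_r(x)$ is the ball of radius $r$ centered at $x$, $|B_r|$ its measure, and $A_rf(x)=\frac1{|B_r|}\int_{B_r(x)}f(y)\,dy$. Morrey-type quasi-norm: $\|f\|_{M^\lambda_{p,q}}=\big(\int_0^\infty(r^{-\lambda}\sup_{x\in\mathbb R^n}\|f\|_{L_p(B_r(x))})^q\frac{dr}r\big)^{1/q}$ (with $\sup_{r>0}r^{-\lambda}\sup_x\|f\|_{L_p(B_r(x))}$ if $q=\infty$). Campanato quasi-norm: $\|f\|_{C_{p,q}^\lambda}=|f|_{C_{p,q}^\lambda}+\sup_{x\in\mathbb R^n}\|f\|_{L_p(B_1(x))}$, where $$|f|_{C_{p,q}^\lambda}=\bigg(\int_0^\infty\bigg(r^{-\lambda}\sup_{x\in\mathbb R^n}\Big(\int_{B_r(x)}|f(y)-A_rf(x)|^p\,dy\Big)^{1/p}\bigg)^q\frac{dr}r\bigg)^{1/q}$$ (with $\sup_{r>0}$ replacing the integral if $q=\infty$). Both quantities may be $+\infty$. *)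

(* Defs.v *)
From HB Require Import structures.
From mathcomp Require Import all_boot all_order all_algebra.
From mathcomp Require Import all_classical all_reals all_analysis.

Set Implicit Arguments.
Unset Strict Implicit.
Unset Printing Implicit Defensive.
Import Order.TTheory GRing.Theory Num.Theory.
Import numFieldNormedType.Exports.
Local Open Scope classical_set_scope.
Local Open Scope ring_scope.

(* R^n is [n.-tuple R]; the canonical sigma-algebra on tuples over
   [measurableTypeR R] (the reals with their Borel sets) is the Borel
   sigma-algebra of R^n. *)

Definition tuple_cons {R : realType} {n : nat}
    (z : measurableTypeR R * n.-tuple (measurableTypeR R)) :
    n.+1.-tuple (measurableTypeR R) :=
  [tuple of z.1 :: z.2].

Lemma measurable_tuple_cons {R : realType} {n : nat} :
  measurable_fun setT (@tuple_cons R n).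
Proof. by apply: measurable_cons. Qed.

Section borel_lebesgue_succ.
Context {R : realType} {n : nat}.
Variable mu : {sigma_finite_measure set (n.-tuple (measurableTypeR R)) -> \bar R}.

Definition borel_lebesgue_succ :
    set (n.+1.-tuple (measurableTypeR R)) -> \bar R :=
  pushforward (lebesgue_measure \x mu)%E tuple_cons.

Let borel_lebesgue_succ0 : borel_lebesgue_succ set0 = 0%E.
Proof. by rewrite /borel_lebesgue_succ /pushforward preimage_set0 measure0. Qed.

Let borel_lebesgue_succ_ge0 A : (0 <= borel_lebesgue_succ A)%E.
Proof. by rewrite /borel_lebesgue_succ /pushforward; exact: measure_ge0. Qed.

Let borel_lebesgue_succ_sigma_additive :
  semi_sigma_additive borel_lebesgue_succ.
Proof.
exact: (@measure_semi_sigma_additive _ _ _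
  (measure_function_pushforward__canonical__measure_function_Measure
     (lebesgue_measure \x mu)%E measurable_tuple_cons)).
Qed.

HB.instance Definition _ := isMeasure.Build _ _ _ borel_lebesgue_succ
  borel_lebesgue_succ0 borel_lebesgue_succ_ge0
  borel_lebesgue_succ_sigma_additive.

Let borel_lebesgue_succ_sigma_finite : sigma_finite setT borel_lebesgue_succ.
Proof.
have /sigma_finiteP[F [TF ndF Foo]] := sigma_finiteT (@lebesgue_measure R).
have /sigma_finiteP[G [TG ndG Goo]] := sigma_finiteT mu.
pose uncons (t : n.+1.-tuple (measurableTypeR R)) :
    measurableTypeR R * n.-tuple (measurableTypeR R) :=
  (thead t, [tuple of behead t]).
have muncons : measurable_fun setT uncons.
  apply: measurable_fun_pair; first exact: measurable_tnth.
  exact: measurable_behead.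
exists (fun i => uncons @^-1` (F i `*` G i)).
  rewrite -preimage_bigcup (_ : \bigcup_i _ = setT) ?preimage_setT//.
  apply/seteqP; split=> // -[x y] _.
  have [i _ Fix] : (\bigcup_i F i) x by rewrite -TF.
  have [j _ Gjy] : (\bigcup_i G i) y by rewrite -TG.
  exists (maxn i j) => //; split => /=.
    by move: x Fix; exact/subsetPset/ndF/leq_maxl.
  by move: y Gjy; exact/subsetPset/ndG/leq_maxr.
move=> i; have [mF Fi] := Foo i; have [mG Gi] := Goo i; split.
  by rewrite -[X in measurable X]setTI; apply: muncons => //; exact: measurableX.
rewrite /borel_lebesgue_succ /pushforward -comp_preimage.
rewrite (_ : uncons \o tuple_cons = id).
  by rewrite preimage_id product_measure1E// lte_mul_pinfty// ge0_fin_numE.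
apply/funext => -[x t]; rewrite /uncons /tuple_cons /= theadE.
by congr pair; apply/val_inj.
Qed.

HB.instance Definition _ := Measure_isSigmaFinite.Build _ _ _
  borel_lebesgue_succ borel_lebesgue_succ_sigma_finite.

End borel_lebesgue_succ.

Fixpoint borel_lebesgue (R : realType) (n : nat) :
    {sigma_finite_measure set (n.-tuple (measurableTypeR R)) -> \bar R} :=
  match n with
  | 0 => \d_([tuple] : 0.-tuple (measurableTypeR R))
  | m.+1 => borel_lebesgue_succ (borel_lebesgue R m)
  end.

Definition lebesgue_outer (R : realType) (n : nat) :
    {outer_measure set (n.-tuple (measurableTypeR R)) -> \bar R} :=
  (borel_lebesgue R n)^*%mu.

(* [euclidean R n] is R^n equipped with the sigma-algebra of all Lebesgue
   measurable sets, i.e. the Caratheodory-measurable sets of the Lebesgue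
   outer measure, and [leb] is the (complete) Lebesgue measure on it. *)
Definition euclidean (R : realType) (n : nat) :=
  caratheodory_type (lebesgue_outer R n).

HB.instance Definition _ (R : realType) (n : nat) :=
  Measurable.on (euclidean R n).

Definition leb (R : realType) (n : nat) :
    {measure set (euclidean R n) -> \bar R} :=
  lebesgue_outer R n : set (caratheodory_type (lebesgue_outer R n)) -> \bar R.

Section morrey_campanato.
Context {R : realType} {n : nat}.
Local Notation Rn := (euclidean R n).
Local Notation mu := (leb R n).
Implicit Types (f g : Rn -> R) (x : Rn) (r p lambda : R) (q : \bar R).

Definition eball x r : set Rn :=
  [set y | Num.sqrt (\sum_(i < n) (tnth y i - tnth x i) ^+ 2) < r].

(* Balls instead of compact sets: every compact subset of R^n lies in a ball,
   and every ball has compact closure. *)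
Definition loc_integrable f :=
  measurable_fun setT f /\
  forall x r, (\int[mu]_(y in eball x r) `|f y|%:E < +oo)%E.

Definition avg r f x : R :=
  (fine (mu (eball x r)))^-1 * \int[mu]_(y in eball x r) f y.

Definition Lp_on p (B : set Rn) g : \bar R :=
  ((\int[mu]_(y in B) (`|g y| `^ p)%:E) `^ p^-1)%E.

(* ( \int_0^oo (r^-lambda phi(r))^q dr/r )^(1/q), resp. the supremum over
   r > 0 of r^-lambda phi(r) when q = +oo; the value at q = -oo is junk. *)
Definition radial_norm lambda q (phi : R -> \bar R) : \bar R :=
  match q with
  | s%:E => ((\int[lebesgue_measure]_(r in `]0%R, +oo[)
                (((r `^ (- lambda))%:E * phi r) `^ s * (r^-1)%:E)) `^ s^-1)%E
  | +oo%E => ereal_sup [set ((r `^ (- lambda))%:E * phi r)%E | r in `]0, +oo[]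
  | -oo%E => 0%E
  end.

Definition morrey_norm p q lambda f : \bar R :=
  radial_norm lambda q
    (fun r => ereal_sup [set Lp_on p (eball x r) f | x in setT]).

Definition campanato_seminorm p q lambda f : \bar R :=
  radial_norm lambda q
    (fun r => ereal_sup
      [set Lp_on p (eball x r) (fun y => f y - avg r f x) | x in setT]).

Definition campanato_norm p q lambda f : \bar R :=
  (campanato_seminorm p q lambda f +
   ereal_sup [set Lp_on p (eball x 1) f | x in setT])%E.

End morrey_campanato.

(* Main.v *)
(* Write A_r for the average over B_r(x). Averages over the balls B_{2^k r}(x)
   telescope and tend to 0, so A_r is at most the sum over k of
   |A_{2^k r} - A_{2^{k+1} r}|, and the k-th term is at most
   |B_{2^k r}|^{-1/p} times the L_p norm of f - A_{2^{k+1} r} on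
   B_{2^{k+1} r}(x). As |B_r| is comparable to r^n, the local L_p norm of f is
   bounded, for any b > 2^{-n/p}, by a constant times
   sup_k b^k w(2^k r), where w is the oscillation of f. Since lambda < n/p one can
   take b < 2^{-lambda}; bounding the q-th power of the supremum by the sum of
   the q-th powers (no Minkowski inequality, hence every q > 0 at once) and
   using the dilation invariance of dr/r gives a convergent geometric series.

   The supremum over x in the Campanato seminorm is not obviously measurable in
   r, and the integral of a nonmeasurable function is only a lower integral,
   which is monotone but not additive. It is therefore replaced by the
   comparable quantity [osc], with the infimum over all constants instead of
   the average: that one is nondecreasing in r, hence measurable. *)
Require Import Defs.
From HB Require Import structures.
From mathcomp Require Import all_boot all_order all_algebra.
From mathcomp Require Import all_classical all_reals all_analysis.
From mathcomp Require Import measurable_realfun.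
From mathcomp Require Import lra ring.

Set Implicit Arguments.
Unset Strict Implicit.
Unset Printing Implicit Defensive.
Import Order.TTheory GRing.Theory Num.Theory.
Import numFieldNormedType.Exports.
Local Open Scope classical_set_scope.
Local Open Scope ring_scope.

(** * Powers and integrals *)

Lemma le_poweR (R : realType) (r : R) (x y : \bar R) :
  0 <= r -> (0 <= x)%E -> (x <= y)%E -> (x `^ r <= y `^ r)%E.
Proof.
move=> r0 x0 xy; apply: gt0_ler_poweR => //; rewrite in_itv/= leey andbT//.
exact: le_trans xy.
Qed.

Lemma powR_exprn (R : realType) (x p : R) (k : nat) :
  0 <= x -> (x ^+ k) `^ p = (x `^ p) ^+ k.
Proof.
move=> x0; elim: k => [|k ih]; first by rewrite !expr0 powR1.
by rewrite !exprS powRM ?exprn_ge0// ih.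
Qed.

(** Measurability is not assumed: the integral of a nonnegative function is a supremum over the
    simple functions below it, and enlarging the function only adds competitors. *)
Lemma le_lower_integral d (T : measurableType d) (R : realType)
    (mu : {measure set T -> \bar R}) (D : set T) (f g : T -> \bar R) :
  (forall x, D x -> 0 <= f x)%E -> (forall x, D x -> f x <= g x)%E ->
  (\int[mu]_(x in D) f x <= \int[mu]_(x in D) g x)%E.
Proof.
move=> f0 fg.
have g0 x : D x -> (0 <= g x)%E by move=> Dx; apply: le_trans (fg _ Dx); exact: f0.
rewrite !ge0_integralE//; apply: le_ereal_sup => _ [h hf <-]; exists h => // x.
apply: le_trans (hf x) _; rewrite /patch; case: ifPn => //.
by rewrite inE; exact: fg.
Qed.

(** * L_p norms and means over a subset of a measure space *)

Section Lp_mean.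
Context d (T : measurableType d) (R : realType).
Variable mu : {measure set T -> \bar R}.
Implicit Types (f g h : T -> R) (B : set T) (p c : R).
Local Open Scope ereal_scope.

(** This and [mean_on] are [Lp_on] and [avg] over an arbitrary measure; for [leb] and a ball they
    are convertible to those, so the results below transfer by unification. *)
Definition Lp_norm_on p B g : \bar R :=
  (\int[mu]_(y in B) (`|g y| `^ p)%:E) `^ p^-1.

Definition mean_on B f : R := ((fine (mu B))^-1 * \int[mu]_(y in B) f y)%R.

(** Passing to the restriction of [g] gives access to the inequalities of Hölder and Minkowski;
    [0 < p] makes the power vanish off [B]. *)
Lemma Lp_norm_on_Lnorm p B g : (0 < p)%R ->
  Lp_norm_on p B g = Lnorm mu p%:E (EFin \o (g \_ B)).
Proof.
move=> p0; rewrite /Lp_norm_on unlock.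
apply: (congr1 (@poweR R ^~ p^-1%R)).
rewrite [LHS]integral_mkcond; apply: eq_integral => y _ /=.
by rewrite /patch; case: ifPn => // _; rewrite normr0 powR0 ?gt_eqF.
Qed.

Lemma le_Lp_norm_on p B B' g : (0 < p)%R -> measurable B -> measurable B' ->
  measurable_fun setT g -> B `<=` B' -> Lp_norm_on p B g <= Lp_norm_on p B' g.
Proof.
move=> p0 mB mB' mg BB'; apply: le_poweR.
- by rewrite invr_ge0 ltW.
- by apply: integral_ge0 => y _; rewrite lee_fin powR_ge0.
apply: ge0_subset_integral => //.
apply/measurable_EFinP; apply: (measurableT_comp (measurable_powR _)).
by apply: measurableT_comp => //; exact: measurable_funS mg.
Qed.

Lemma Lp_norm_on_cst p B c : (0 < p)%R -> measurable B ->
  Lp_norm_on p B (fun=> c) = `|c|%:E * mu B `^ p^-1.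
Proof.
move=> p0 mB; rewrite /Lp_norm_on integral_cst// poweRM ?lee_fin ?powR_ge0//.
by rewrite poweR_EFin -powRrM mulfV ?gt_eqF// powRr1.
Qed.

Lemma Lp_norm_on_triangle p B g h : (1 <= p)%R -> measurable B ->
  measurable_fun setT g -> measurable_fun setT h ->
  Lp_norm_on p B (fun y => g y + h y)%R <= Lp_norm_on p B g + Lp_norm_on p B h.
Proof.
move=> p1 mB mg mh; have p0 : (0 < p)%R := lt_le_trans ltr01 p1.
rewrite !Lp_norm_on_Lnorm//.
apply: le_trans (minkowski_EFin _ _ _ p1); last 2 first.
- by apply/(measurable_restrictT _ _).1 => //; exact: measurable_funS mg.
- by apply/(measurable_restrictT _ _).1 => //; exact: measurable_funS mh.
rewrite le_eqVlt; apply/orP; left; apply/eqP/eq_Lnorm => y /=.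
by rewrite /patch; case: ifPn => // _; rewrite addr0.
Qed.

(** Hölder's inequality against the indicator of [B]. For p = 1 the conjugate exponent would be
    infinite, so that case is treated apart. *)
Lemma integral_norm_le_Lp_norm_on p B g : (1 <= p)%R -> measurable B ->
  measurable_fun setT g ->
  \int[mu]_(y in B) `|g y|%:E <= mu B `^ (1 - p^-1) * Lp_norm_on p B g.
Proof.
rewrite le_eqVlt => /predU1P[<-|p1] mB mg.
  rewrite invr1 subrr poweRe0 mul1e /Lp_norm_on invr1 poweRe1 ?integral_ge0//.
  rewrite le_eqVlt; apply/orP; left; apply/eqP; apply: eq_integral => y _.
  by rewrite powRr1.
have p0 : (0 < p)%R := lt_trans ltr01 p1.
have p10 : (0 < p - 1)%R by rewrite subr_gt0.
pose q := (p / (p - 1))%R.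
have q0 : (0 < q)%R by rewrite divr_gt0.
have pq : (p^-1 + q^-1 = 1)%R by rewrite /q invf_div; field; rewrite gt_eqF.
have mB1 : measurable_fun [set: T] (\1_B : T -> R) by exact: measurable_indic.
have mgB : measurable_fun [set: T] (g \_ B).
  by apply/(measurable_restrictT _ _).1 => //; exact: measurable_funS mg.
have := hoelder mu mgB mB1 p0 q0 pq.
rewrite Lnorm1 -Lp_norm_on_Lnorm// muleC.
rewrite (_ : Lnorm mu q%:E _ = mu B `^ (1 - p^-1)).
  apply: le_trans; rewrite [leLHS]integral_mkcond.
  rewrite le_eqVlt; apply/orP; left; apply/eqP; apply: eq_integral => y _ /=.
  rewrite /patch indicE; case: ifPn => yB; first by rewrite mulr1.
  by rewrite mulr0 normr0.
have -> : (1 - p^-1 = q^-1)%R by rewrite -pq addrC addKr.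
have := @Lp_norm_on_cst q B 1%R q0 mB; rewrite normr1 mul1e => <-.
rewrite Lp_norm_on_Lnorm//; apply: eq_Lnorm => y /=.
by rewrite /patch indicE; case: ifPn.
Qed.

Section mean.
Variables (B : set T) (f : T -> R).
Hypotheses (mB : measurable B) (muB_fin : mu B \is a fin_num) (muB0 : 0 < mu B).
Hypotheses (mf : measurable_fun setT f) (if_ : mu.-integrable B (EFin \o f)).

Let v := fine (mu B).

Let v0 : (0 < v)%R.
Proof. by rewrite fine_gt0// muB0 -ge0_fin_numE. Qed.

Let integrable_cst c : mu.-integrable B (EFin \o (fun=> c)).
Proof.
apply/integrableP; split; first exact: measurable_cst.
rewrite [X in X < _](_ : _ = `|c|%:E * mu B) -?integral_cst//.
by rewrite integral_cst// -(fineK muB_fin) -EFinM ltry.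
Qed.

Lemma mean_on_sub c :
  (mean_on B f - c = v^-1 * \int[mu]_(y in B) (f y - c))%R.
Proof.
rewrite (RintegralB mB if_ (integrable_cst c)) (Rintegral_cst _ mB) /mean_on.
by rewrite -/v; field; rewrite gt_eqF.
Qed.

Let measurable_subc c : measurable_fun setT (fun y => f y - c)%R.
Proof. exact: measurable_funB. Qed.

(** The mean of f - c is at most 1/v times the integral of |f - c|, which Hölder's inequality bounds
    by v^(1 - 1/p) times the norm. Multiplying by v^(1/p) cancels all powers of v. *)
Lemma mean_on_sub_le p c : (1 <= p)%R ->
  `|mean_on B f - c|%:E * mu B `^ p^-1 <= Lp_norm_on p B (fun y => f y - c)%R.
Proof.
move=> p1.
have ifc : mu.-integrable B (EFin \o (fun y => f y - c)%R).
  by have := integrableB mB if_ (integrable_cst c).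
have := integral_norm_le_Lp_norm_on p1 mB (measurable_subc c).
have vi0 : (0 <= v^-1)%R by rewrite invr_ge0 ltW.
rewrite mean_on_sub normrM (ger0_norm vi0).
set I := \int[mu]_(y in B) `|(f y - c)%R|%:E.
have I_fin : I \is a fin_num.
  rewrite ge0_fin_numE ?integral_ge0//.
  by have /integrableP[] := ifc.
have le_I : (`|\int[mu]_(y in B) (f y - c)| <= fine I)%R.
  exact: le_normr_Rintegral.
rewrite -(fineK muB_fin) !poweR_EFin -/v => H.
apply: (@le_trans _ _ ((v^-1 * v `^ p^-1)%:E * I)).
  rewrite -(fineK I_fin) -!EFinM lee_fin mulrAC ler_wpM2l//.
  by rewrite mulr_ge0 ?powR_ge0.
apply: le_trans (lee_wpmul2l _ H) _.
  by rewrite lee_fin mulr_ge0 ?powR_ge0.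
rewrite muleA -EFinM -mulrA -powRD; last by rewrite (gt_eqF v0) implybT.
by rewrite subrKC (powRr1 (ltW v0)) mulVf ?gt_eqF// mul1e.
Qed.

(** Split f - mean as (f - c) + (c - mean): by [mean_on_sub_le] the constant part costs no more than
    the first one. Up to a factor 2, the mean is thus as good as any constant. *)
Lemma Lp_norm_on_sub_mean p c : (1 <= p)%R ->
  Lp_norm_on p B (fun y => f y - mean_on B f)%R
    <= 2%:E * Lp_norm_on p B (fun y => f y - c)%R.
Proof.
move=> p1.
have := Lp_norm_on_triangle p1 mB (measurable_subc c)
  (measurable_cst (c - mean_on B f)%R).
rewrite [X in X <= _](_ : _ = Lp_norm_on p B (fun y => f y - mean_on B f)%R);
  last by apply: (congr1 (Lp_norm_on p B)); apply/funext => y; rewrite addrA subrK.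
move=> /le_trans; apply; rewrite Lp_norm_on_cst//; last exact: lt_le_trans p1.
by rewrite mule_natl mule2n leeD2l// distrC; exact: mean_on_sub_le.
Qed.

Lemma Lp_norm_on_le_mean p : (1 <= p)%R ->
  Lp_norm_on p B f <= Lp_norm_on p B (fun y => f y - mean_on B f)%R
    + `|mean_on B f|%:E * mu B `^ p^-1.
Proof.
move=> p1.
have := Lp_norm_on_triangle p1 mB (measurable_subc (mean_on B f))
  (measurable_cst (mean_on B f)).
rewrite [X in X <= _](_ : _ = Lp_norm_on p B f);
  last by apply: (congr1 (Lp_norm_on p B)); apply/funext => y; rewrite subrK.
by move=> /le_trans; apply; rewrite Lp_norm_on_cst//; exact: lt_le_trans p1.
Qed.

End mean.
End Lp_mean.

(** * Volume of Euclidean balls *)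

Definition cube (R : realType) (n : nat) (x : n.-tuple R) (h : R) :
    set (n.-tuple (measurableTypeR R)) :=
  [set y | forall i, ball (tnth x i) h (tnth y i)].

Lemma measurable_cube (R : realType) (n : nat) (x : n.-tuple R) (h : R) :
  measurable (cube x h).
Proof.
rewrite (_ : cube x h =
  \bigcap_(i in [set: 'I_n]) ((fun y : n.-tuple (measurableTypeR R) => tnth y i)
     @^-1` ball (tnth x i) h)); last first.
  by apply/seteqP; split => [y xy i _|y xy i]; [exact: xy|exact: (xy i I)].
apply: fin_bigcap_measurable => // i _.
rewrite -[X in measurable X]setTI; apply: measurable_tnth => //.
exact: measurable_ball.
Qed.

(** Induction on the dimension: [tuple_cons] pulls the cube back to the product of an interval of
    length 2h and a cube of one dimension less. In dimension 0 the Dirac mass matches the empty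
    product. *)
Lemma borel_lebesgue_cube (R : realType) (n : nat) (x : n.-tuple R) (h : R) :
  0 < h -> borel_lebesgue R n (cube x h) = ((2 * h) ^+ n)%:E.
Proof.
move=> h0; elim: n x => [|n ih] x.
  rewrite /= diracE expr0 mem_set//.
  by move=> -[].
rewrite /= /borel_lebesgue_succ /pushforward.
rewrite (_ : tuple_cons @^-1` _ = ball (thead x) h `*` cube [tuple of behead x] h).
  rewrite product_measure1E ?ih; [|exact: measurable_ball|exact: measurable_cube].
  rewrite [X in (X * _)%E](_ : _ = (2 * h)%:E) ?exprS//.
  by rewrite [LHS]lebesgue_measure_ball ?ltW// mulr2n mulrDl mul1r.
apply/seteqP; split => -[a y] /=.
  move=> H; split.
    by have := H ord0; rewrite /thead !(tnth_nth 0).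
  move=> i; have := H (lift ord0 i).
  by rewrite !(tnth_nth 0)/= nth_behead.
move=> [Ha Hy] i; case: (unliftP ord0 i) => [j|] ->.
  by have := Hy j; rewrite !(tnth_nth 0)/= nth_behead.
by move: Ha; rewrite /thead !(tnth_nth 0).
Qed.

Lemma measurable_eball_borel (R : realType) (n : nat) (x : euclidean R n) (r : R) :
  measurable (eball x r : set (n.-tuple (measurableTypeR R))).
Proof.
rewrite -[X in measurable X]setTI.
pose g := fun y : n.-tuple (measurableTypeR R) =>
  Num.sqrt (\sum_(i < n) (tnth y i - tnth x i) ^+ 2).
have mg : measurable_fun setT g.
  apply: (@measurableT_comp _ _ _ _ _ _ (@Num.sqrt R)).
    by apply: continuous_measurable_fun; exact: sqrt_continuous.
  apply: measurable_sum => i; apply: measurable_funX.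
  by apply: measurable_funB => //; exact: measurable_tnth.
rewrite (_ : eball x r = g @^-1` `]-oo, r[); last first.
  by apply/seteqP; split => y /=; rewrite in_itv.
exact: mg.
Qed.

Lemma leb_borel (R : realType) (n : nat)
    (A : set (n.-tuple (measurableTypeR R))) :
  measurable A -> measurable (A : set (euclidean R n)) /\
    leb R n A = borel_lebesgue R n A.
Proof.
move=> mA; split; last exact: measurable_mu_extE.
by apply: sub_caratheodory; exact: sub_sigma_algebra.
Qed.

Lemma eball_sub_cube (R : realType) (n : nat) (x : euclidean R n) (r : R) :
  eball x r `<=` cube (x : n.-tuple R) r.
Proof.
move=> y xy i; rewrite /ball/= distrC -sqrtr_sqr; apply: le_lt_trans xy.
rewrite ler_wsqrtr// (bigD1 i)//= lerDl.
by apply: sumr_ge0 => j _; exact: sqr_ge0.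
Qed.

(* The optimal side is r / sqrt n; r / n.+1 is enough and needs no n > 0. *)
Lemma cube_sub_eball (R : realType) (n : nat) (x : euclidean R n) (r : R) :
  0 < r -> cube (x : n.-tuple R) (r / n.+1%:R) `<=` eball x r.
Proof.
move=> r0 y xy; rewrite /eball/= -[ltRHS]ger0_norm ?ltW// -sqrtr_sqr.
rewrite ltr_sqrt ?exprn_gt0//.
have h0 : 0 <= r / n.+1%:R by rewrite divr_ge0// ltW.
apply: (@le_lt_trans _ _ (\sum_(i < n) (r / n.+1%:R) ^+ 2)).
  apply: ler_sum => i _; rewrite -real_normK ?num_real// lerXn2r ?nnegrE//.
  by rewrite distrC; exact/ltW/(xy i).
rewrite sumr_const card_ord -[_ *+ n]mulr_natl exprMn mulrCA -[ltRHS]mulr1.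
rewrite ltr_pM2l ?exprn_gt0// exprVn ltr_pdivrMr ?exprn_gt0// mul1r.
by rewrite -natrX ltr_nat expnS expn1 leq_pmulr.
Qed.

(** Comparability with r^n suffices, so the ball is squeezed between two cubes and its exact volume
    is never computed. *)
Lemma leb_eball_bounds (R : realType) (n : nat) (x : euclidean R n) (r : R) :
  0 < r -> (((2 / n.+1%:R) ^+ n * r ^+ n)%:E <= leb R n (eball x r)
    <= (2 ^+ n * r ^+ n)%:E)%E.
Proof.
move=> r0; have h0 : 0 < r / n.+1%:R by rewrite divr_gt0.
have [_ ->] := leb_borel (measurable_eball_borel x r).
rewrite -!exprMn mulrAC -mulrA.
rewrite -(borel_lebesgue_cube (x : n.-tuple R) h0).
rewrite -(borel_lebesgue_cube (x : n.-tuple R) r0).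
apply/andP; split.
  apply: le_measure; rewrite ?inE; [exact: measurable_cube|exact: measurable_eball_borel|].
  exact: cube_sub_eball.
apply: le_measure; rewrite ?inE; [exact: measurable_eball_borel|exact: measurable_cube|].
exact: eball_sub_cube.
Qed.

Lemma measurable_eball (R : realType) (n : nat) (x : euclidean R n) (r : R) :
  measurable (eball x r).
Proof. by have [] := leb_borel (measurable_eball_borel x r). Qed.

Lemma subset_eball (R : realType) (n : nat) (x : euclidean R n) (r s : R) :
  r <= s -> eball x r `<=` eball x s.
Proof. by move=> rs y /lt_le_trans; exact. Qed.

Lemma leb_eball_fin_num (R : realType) (n : nat) (x : euclidean R n) (r : R) :
  0 < r -> leb R n (eball x r) \is a fin_num.
Proof.
move=> r0; have /andP[_ H] := leb_eball_bounds x r0.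
by rewrite ge0_fin_numE// (le_lt_trans H)// ltry.
Qed.

Lemma fine_leb_eball_gt0 (R : realType) (n : nat) (x : euclidean R n) (r : R) :
  0 < r -> 0 < fine (leb R n (eball x r)).
Proof.
move=> r0; have /andP[+ _] := leb_eball_bounds x r0.
rewrite -[leb _ _ _]fineK ?leb_eball_fin_num// lee_fin; apply: lt_le_trans.
by rewrite mulr_gt0// exprn_gt0// divr_gt0.
Qed.

(** Both volumes are compared directly with powers of the radius, so the loss does not depend on
    [k]; iterating a doubling inequality would multiply the losses. *)
Lemma fine_leb_eball_pow2 (R : realType) (n : nat) (x : euclidean R n) (r : R)
    (k : nat) : 0 < r ->
  n.+1%:R ^- n * (2 ^+ n) ^+ k * fine (leb R n (eball x r))
    <= fine (leb R n (eball x (2 ^+ k * r))).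
Proof.
move=> r0; have kr0 : 0 < 2 ^+ k * r by rewrite mulr_gt0 ?exprn_gt0.
have /andP[_] := leb_eball_bounds x r0.
have /andP[+ _] := leb_eball_bounds x kr0.
rewrite -[leb _ _ _]fineK ?leb_eball_fin_num// lee_fin.
rewrite -[leb _ _ (eball x r)]fineK ?leb_eball_fin_num// lee_fin.
move=> Hk H; apply: le_trans Hk; rewrite -exprVn.
apply: le_trans (ler_wpM2l _ H) _; first by rewrite mulr_ge0 ?exprn_ge0.
by rewrite !exprMn -!exprM mulnC le_eqVlt; apply/orP; left; apply/eqP; ring.
Qed.

(** * Radial norms *)

(** Preimages of upper half-lines are upward closed, hence intervals. *)
Lemma nondecreasing_emeasurable (R : realType) (D : set R) (f : R -> \bar R) :
  measurable D -> {homo f : x y / x <= y >-> (x <= y)%E} -> measurable_fun D f.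
Proof.
move=> mD f_nd.
apply: (measurability (@ErealGenCInfty.G R)) => [|/= _ [_] [r] -> <-].
  exact: ErealGenCInfty.measurableE.
apply: measurableI => //; apply: is_interval_measurable => s t/=.
rewrite !in_itv/= !andbT => fs ft u /andP[su ut].
by rewrite in_itv/= andbT (le_trans fs)// f_nd.
Qed.

(** The pushforward multiplied by [a] agrees with Lebesgue measure on half-open intervals, so
    uniqueness identifies the two. *)
Lemma lebesgue_measure_scale (R : realType) (a : R) (A : set R) : 0 < a ->
  measurable A ->
  pushforward lebesgue_measure ( *%R a : _ -> measurableTypeR R) A
    = (a^-1%:E * lebesgue_measure A)%E.
Proof.
move=> a0 mA.
have ma : measurable_fun setT ( *%R a : measurableTypeR R -> measurableTypeR R).
  exact: measurable_funM.
pose push := measure_function_pushforward__canonical__measure_function_Measure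
  (@lebesgue_measure R) ma.
pose m : {measure set (measurableTypeR R) -> \bar R} :=
  mscale (NngNum (ltW a0)) push.
have mE X : ocitv X -> lebesgue_measure X = m X.
  move=> [[b c] _ <-].
  have scaleE : (( *%R a : R -> R) @^-1` `]b, c] = `](b / a), (c / a)])%classic.
    apply/seteqP; split => r; rewrite /= !in_itv/= ltr_pdivrMr// ler_pdivlMr//;
      by rewrite (mulrC a).
  transitivity (a%:E * lebesgue_measure (( *%R a : R -> R) @^-1` `]b, c]%classic))%E.
    rewrite scaleE !lebesgue_measure_itv/= !lte_fin ltr_pM2r ?invr_gt0//.
    case: ifPn => _; last by rewrite mule0.
    by rewrite -!EFinB -EFinM -mulrBl mulrCA mulfV ?gt_eqF// mulr1.
  by [].
rewrite (lebesgue_measure_unique mE mA) /m /mscale/= muleA -EFinM.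
by rewrite mulVf ?gt_eqF// mul1e.
Qed.

Lemma ge0_integral_scale (R : realType) (a : R) (h : R -> \bar R) : 0 < a ->
  measurable_fun (`]0%R, +oo[%classic : set R) h ->
  (forall r, 0 < r -> (0 <= h r)%E) ->
  (\int[lebesgue_measure]_(r in `]0%R, +oo[) h (a * r)%R =
   a^-1%:E * \int[lebesgue_measure]_(r in `]0%R, +oo[) h r)%E.
Proof.
move=> a0 mh h0.
have ma : measurable_fun setT ( *%R a : measurableTypeR R -> measurableTypeR R).
  exact: measurable_funM.
have aE : (( *%R a : R -> R) @^-1` `]0, +oo[ = `]0, +oo[)%classic.
  by apply/seteqP; split => r; rewrite /= !in_itv/= !andbT pmulr_rgt0.
have ai0 : 0 <= a^-1 by rewrite invr_ge0 ltW.
have h0D r : `]0%R, +oo[%classic r -> (0 <= h r)%E.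
  by rewrite /= in_itv/= andbT; exact: h0.
rewrite -{1}aE -(@ge0_integral_pushforward _ _ _ _ _ _ ma)//; last first.
  by move=> r; rewrite inE; exact: h0D.
rewrite -(ge0_integral_mscale _ _ (NngNum ai0))//.
apply: eq_measure_integral => //= A mA _.
exact: lebesgue_measure_scale.
Qed.

Section radial_norm.
Context {R : realType}.
Implicit Types (lambda s b C r : R) (q : \bar R) (phi psi : R -> \bar R).

(** Applied with [campanato_sup] as [psi], which need not be measurable; the integrals are therefore
    compared as lower integrals. *)
Lemma le_radial_norm lambda q phi psi : (0 < q)%E ->
  (forall r, 0 < r -> (0 <= phi r)%E) -> (forall r, 0 < r -> (phi r <= psi r)%E) ->
  (radial_norm lambda q phi <= radial_norm lambda q psi)%E.
Proof.
move=> q0 phi0 le_phi; case: q q0 => [s||//] q0 /=.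
  have s0 : 0 <= s by rewrite -lee_fin ltW.
  apply: le_poweR; first by rewrite invr_ge0.
    apply: integral_ge0 => r /=; rewrite in_itv/= andbT => r0.
    by rewrite mule_ge0 ?poweR_ge0// lee_fin invr_ge0 ltW.
  apply: le_lower_integral => r /=; rewrite in_itv/= andbT => r0.
    by rewrite mule_ge0 ?poweR_ge0// lee_fin invr_ge0 ltW.
  apply: lee_wpmul2r; first by rewrite lee_fin invr_ge0 ltW.
  apply: le_poweR => //; first by rewrite mule_ge0 ?lee_fin ?powR_ge0 ?phi0.
  by apply: lee_wpmul2l; [rewrite lee_fin powR_ge0|exact: le_phi].
apply: ge_ereal_sup => _ [r /= r0 <-].
apply: (@le_trans _ _ ((r `^ (- lambda))%:E * psi r)%E); last first.
  by apply: ereal_sup_ubound; exists r.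
apply: lee_wpmul2l; first by rewrite lee_fin powR_ge0.
by apply: le_phi; move: r0; rewrite in_itv/= andbT.
Qed.

Lemma measurable_radial lambda s phi : {homo phi : x y / x <= y >-> (x <= y)%E} ->
  measurable_fun (`]0%R, +oo[%classic : set R)
    (fun r => ((r `^ (- lambda))%:E * phi r) `^ s * (r^-1)%:E)%E.
Proof.
move=> phi_nd; apply: emeasurable_funM.
  apply: (measurableT_comp (measurable_poweR _)); apply: emeasurable_funM.
    apply/measurable_EFinP.
    exact: measurable_funS (measurable_powR _).
  exact: nondecreasing_emeasurable.
apply/measurable_EFinP.
apply: (@eq_measurable_fun _ _ _ _ _ (@powR R ^~ (-1))).
  by move=> r; rewrite inE/= in_itv/= andbT => r0; rewrite powR_inv1// ltW.
exact: measurable_funS (measurable_powR _).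
Qed.

(** Controls the unit-ball term of the Campanato norm. For finite q, the integrand is bounded below
    on [1, 2], an interval of length 1; for q = +oo the radius 1 is a competitor. *)
Lemma radial_norm_ge1 lambda q : 0 < lambda -> (0 < q)%E ->
  exists2 C, 0 < C & forall phi, {homo phi : x y / x <= y >-> (x <= y)%E} ->
    (forall r, 0 <= phi r)%E -> (phi 1%R <= C%:E * radial_norm lambda q phi)%E.
Proof.
move=> l0; case: q => [s||//] q0; last first.
  exists 1 => // phi _ phi0; rewrite mul1e; apply: ereal_sup_ubound.
  by exists 1; rewrite /= ?in_itv/= ?ltr01// powR1 mul1e.
have s0 : 0 < s by rewrite -lte_fin.
(* The factors undo the lower bounds 2^(-lambda) for the weight and 1/2 for 1/r on [1, 2], the
   latter after the s-th root. *)
exists (2 `^ lambda * 2 `^ s^-1); first by rewrite mulr_gt0// powR_gt0.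
move=> phi phi_nd phi0 /=.
set I := (\int[_]_(r in _) _)%E.
have HI : (((2 `^ (- lambda))%:E * phi 1%R) `^ s * 2^-1%:E <= I)%E.
  apply: (@le_trans _ _ (\int[lebesgue_measure]_(r in `[1%R, 2%R])
      (cst (((2 `^ (- lambda))%:E * phi 1%R) `^ s * 2^-1%:E) r))%E).
    have L12 : lebesgue_measure (`[1%R, 2%R]%classic : set R) = 1%:E.
      rewrite lebesgue_measure_itv/= lte_fin ltr1n -EFinB.
      by congr EFin; lra.
    by rewrite integral_cst// [X in (_ <= _ * X)%E]L12 mule1.
  apply: (@le_trans _ _ (\int[lebesgue_measure]_(r in `[1%R, 2%R])
      (((r `^ (- lambda))%:E * phi r) `^ s * (r^-1)%:E))%E).
    apply: le_lower_integral => r /=; rewrite in_itv/= => /andP[r1 r2].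
      by rewrite mule_ge0 ?poweR_ge0// lee_fin.
    have r0 : 0 < r by rewrite (lt_le_trans _ r1).
    apply: lee_pmul; rewrite ?poweR_ge0 ?lee_fin ?invr_ge0//.
      apply: le_poweR; [exact: ltW|by rewrite mule_ge0 ?lee_fin ?powR_ge0|].
      apply: lee_pmul => //; rewrite ?lee_fin ?powR_ge0//; last exact: phi_nd.
      rewrite !powRN lef_pV2 ?posrE ?powR_gt0//.
      by apply: ge0_ler_powR; rewrite ?nnegrE//; exact: ltW.
    by rewrite lef_pV2 ?posrE.
  apply: ge0_subset_integral => //.
  - exact: measurable_radial.
  - move=> r /=; rewrite in_itv/= andbT => r0.
    by rewrite mule_ge0 ?poweR_ge0// lee_fin invr_ge0 ltW.
  - by move=> r /=; rewrite !in_itv/= andbT => /andP[r1 _]; rewrite (lt_le_trans _ r1).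
have : (phi 1%R = (2 `^ lambda * 2 `^ s^-1)%:E *
    (((2 `^ (- lambda))%:E * phi 1%R) `^ s * 2^-1%:E) `^ s^-1)%E.
  rewrite poweRM ?poweR_ge0 ?lee_fin ?invr_ge0// -poweRrM mulfV ?gt_eqF//.
  rewrite poweRe1; last by rewrite mule_ge0 ?lee_fin ?powR_ge0.
  rewrite poweR_EFin muleAC -muleA muleA -!EFinM muleA -EFinM.
  have -> : 2^-1 `^ s^-1 = (2 `^ s^-1)^-1 :> R.
    by rewrite -[X in X `^ _ = _]powR_inv1// -powRrM mulN1r powRN.
  rewrite powRN.
  rewrite [X in (X%:E * _)%E](_ : _ = 1) ?mul1e//.
  by field; rewrite !gt_eqF ?powR_gt0.
move=> {1}->; apply: lee_wpmul2l; first by rewrite lee_fin mulr_ge0 ?powR_ge0.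
apply: le_poweR => //; first by rewrite invr_ge0 ltW.
by rewrite mule_ge0 ?poweR_ge0 ?lee_fin ?invr_ge0.
Qed.

End radial_norm.

(** * Radial norms of dyadic suprema *)

Section dyadic.
Context {R : realType}.
Implicit Types (lambda s b C r : R) (q : \bar R) (phi psi : R -> \bar R).

(** Moves the weight from radius r to radius 2^k r; the price is the k-th power of a ratio that is
    less than 1 in the application. *)
Let dyadic_weight lambda b r k : 0 < r ->
  r `^ (- lambda) * b ^+ k =
  (b * 2 `^ lambda) ^+ k * (2 ^+ k * r) `^ (- lambda).
Proof.
move=> r0; rewrite powRM ?exprn_ge0// ?ltW// exprMn -(powR_mulrn k (ler0n _ 2)).
rewrite -powRrM -(powR_mulrn k (powR_ge0 2 lambda)) -powRrM mulrN powRN (mulrC k%:R).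
rewrite powRN; field.
by rewrite !gt_eqF ?powR_gt0.
Qed.

(** Bounding the partial sums before passing to the limit also covers an infinite [I]. *)
Let geometric_eseries_le d C (I : \bar R) : 0 < d -> d < 1 -> 0 <= C ->
  (0 <= I)%E -> (\sum_(0 <= k <oo) (C * d ^+ k)%:E * I <= (C / (1 - d))%:E * I)%E.
Proof.
move=> d0 d1 C0 I0; apply: lime_le.
  by apply: is_cvg_nneseries => k _ _; rewrite mule_ge0// lee_fin mulr_ge0 ?exprn_ge0// ltW.
apply: nearW => m; rewrite -ge0_sume_distrl; last first.
  by move=> k _; rewrite lee_fin mulr_ge0 ?exprn_ge0// ltW.
rewrite lee_wpmul2r// sumEFin lee_fin.
by apply: (@geometric_le_lim R m C d) => //; rewrite gtr0_norm.
Qed.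

(** Serves both inequalities of the theorem. Monotonicity makes [psi] measurable, which the exchange
    of sum and integral requires, while [phi] enters only through a comparison of lower
    integrals. *)
Lemma radial_norm_dyadic lambda q b C : (0 < q)%E -> 0 < b ->
  b * 2 `^ lambda < 1 -> 0 < C ->
  exists2 D, 0 < D & forall phi psi,
    {homo psi : x y / x <= y >-> (x <= y)%E} -> (forall r, 0 <= psi r)%E ->
    (forall r, 0 < r -> (0 <= phi r)%E) ->
    (forall r, 0 < r -> (phi r <= C%:E *
       ereal_sup (range (fun k => (b ^+ k)%:E * psi (2 ^+ k * r)%R)))%E) ->
    (radial_norm lambda q phi <= D%:E * radial_norm lambda q psi)%E.
Proof.
move=> q0 b0 b1 C0.
have bl0 : 0 < b * 2 `^ lambda by rewrite mulr_gt0 ?powR_gt0.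
case: q q0 => [s||//] q0; last first.
  exists C => // phi psi psi_nd psi0 phi0 le_phi.
  set N := radial_norm lambda +oo psi.
  apply: ge_ereal_sup => _ [r /= + <-]; rewrite in_itv/= andbT => r0.
  have supN : (ereal_sup (range (fun k => (b ^+ k)%:E * psi (2 ^+ k * r)%R))
      <= (r `^ lambda)%:E * N)%E.
    apply: ge_ereal_sup => _ [k _ <-].
    have kr0 : 0 < 2 ^+ k * r by rewrite mulr_gt0 ?exprn_gt0.
    have HN : (((2 ^+ k * r) `^ (- lambda))%:E * psi (2 ^+ k * r)%R <= N)%E.
      by apply: ereal_sup_ubound; exists (2 ^+ k * r) => //=; rewrite in_itv/= andbT.
    have N0 : (0 <= N)%E.
      by apply: le_trans HN; rewrite mule_ge0 ?lee_fin ?powR_ge0.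
    have -> : b ^+ k = r `^ lambda *
        ((b * 2 `^ lambda) ^+ k * (2 ^+ k * r) `^ (- lambda)).
      rewrite -dyadic_weight// mulrA powRN mulfV ?mul1r//.
      by rewrite gt_eqF ?powR_gt0.
    rewrite EFinM -muleA; apply: lee_wpmul2l; first by rewrite lee_fin powR_ge0.
    rewrite EFinM -muleA -[leRHS]mul1e.
    apply: lee_pmul => //; first by rewrite lee_fin exprn_ge0// ltW.
      by rewrite mule_ge0 ?lee_fin ?powR_ge0.
    by rewrite lee_fin exprn_ile1// ltW.
  apply: (@le_trans _ _ ((r `^ (- lambda))%:E * (C%:E * ((r `^ lambda)%:E * N)))%E).
    apply: lee_wpmul2l; first by rewrite lee_fin powR_ge0.
    apply: (le_trans (le_phi _ r0)); apply: lee_wpmul2l => //.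
    by rewrite lee_fin ltW.
  rewrite !muleA -!EFinM powRN mulrAC mulVf ?mul1r// gt_eqF// powR_gt0//.
have s0 : 0 < s by rewrite -lte_fin.
set d := (b * 2 `^ lambda) `^ s.
have d0 : 0 < d by rewrite powR_gt0.
have d1 : d < 1.
  have := gt0_ltr_powR s0 _ _ b1; rewrite powR1 !nnegrE; apply => //.
  exact: ltW.
have K0 : 0 < C `^ s / (1 - d) by rewrite divr_gt0 ?powR_gt0// subr_gt0.
(* The s-th root of the sum of the geometric series with first term C^s and ratio [d]. *)
exists ((C `^ s / (1 - d)) `^ s^-1); first by rewrite powR_gt0.
move=> phi psi psi_nd psi0 phi0 le_phi /=.
set G := fun r => (((r `^ (- lambda))%:E * psi r) `^ s * (r^-1)%:E)%E.
have mG : measurable_fun (`]0%R, +oo[%classic : set R) G.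
  exact: measurable_radial.
have G0 r : 0 < r -> (0 <= G r)%E.
  by move=> r0; rewrite mule_ge0 ?poweR_ge0// lee_fin invr_ge0 ltW.
pose I := (\int[lebesgue_measure]_(r in `]0%R, +oo[) G r)%E.
rewrite -[X in (_ <= _ * (X `^ _))%E]/I.
have I0 : (0 <= I)%E.
  by apply: integral_ge0 => r /=; rewrite in_itv/= andbT; exact: G0.
rewrite -poweR_EFin -poweRM ?lee_fin ?(ltW K0)//.
apply: le_poweR.
- by rewrite invr_ge0 ltW.
- apply: integral_ge0 => r /=; rewrite in_itv/= andbT => r0.
  by rewrite mule_ge0 ?poweR_ge0// lee_fin invr_ge0 ltW.
(* The factor 2^k turns the 1/(2^k r) contained in [G] into 1/r; the change of variables cancels it
   at the end. *)
pose F k r := ((C `^ s * d ^+ k * 2 ^+ k)%:E * G (2 ^+ k * r)%R)%E.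
have F0 k r : 0 < r -> (0 <= F k r)%E.
  move=> r0; rewrite mule_ge0 ?G0 ?mulr_gt0 ?exprn_gt0//.
  by rewrite lee_fin !mulr_ge0 ?exprn_ge0 ?powR_ge0.
have mGk k : measurable_fun (`]0%R, +oo[%classic : set R)
    (fun r => G (2 ^+ k * r)).
  apply: (@measurable_comp _ _ _ _ _ _ (`]0%R, +oo[%classic : set R) G _
    ( *%R (2 ^+ k) : R -> R)) => //.
  move=> _ [r /= + <-]; rewrite !in_itv/= !andbT => r0.
  by rewrite mulr_gt0 ?exprn_gt0.
apply: (@le_trans _ _ (\int[lebesgue_measure]_(r in `]0%R, +oo[)
    (\sum_(0 <= k <oo) F k r))%E).
  apply: le_lower_integral => r /=; rewrite in_itv/= andbT => r0.
    by rewrite mule_ge0 ?poweR_ge0// lee_fin invr_ge0 ltW.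
  pose u k := (((r `^ (- lambda))%:E * ((b ^+ k)%:E * psi (2 ^+ k * r)%R)) `^ s)%E.
  have FE k : F k r = ((C `^ s)%:E * (r^-1)%:E * u k)%E.
    have uE : u k = ((d ^+ k)%:E *
        (((2 ^+ k * r) `^ (- lambda))%:E * psi (2 ^+ k * r)%R) `^ s)%E.
      rewrite /u [X in poweR X]muleA -EFinM (dyadic_weight lambda b k r0).
      rewrite EFinM -[X in poweR X]muleA [LHS]poweRM; last 2 first.
      - by rewrite lee_fin exprn_ge0// ltW.
      - by rewrite mule_ge0// lee_fin powR_ge0.
      rewrite poweR_EFin -powR_mulrn ?(ltW bl0)// powRAC.
      by rewrite powR_mulrn ?powR_ge0.
    rewrite uE /F /G; set X := (_ `^ s)%E.
    rewrite (muleC X) [LHS]muleA [RHS]muleA -!EFinM.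
    apply: (congr1 (fun z => (z%:E * X)%E)).
    by rewrite invfM; field; rewrite expf_neq0//= gt_eqF.
  have u0 k : (0 <= u k)%E by exact: poweR_ge0.
  have -> : (\sum_(0 <= k <oo) F k r = (C `^ s * r^-1)%:E * \sum_(0 <= k <oo) u k)%E.
    by rewrite -nneseriesZl//; apply: eq_eseriesr => k _; rewrite FE EFinM.
  set T := (\sum_(0 <= k <oo) u k)%E.
  have T0 : (0 <= T)%E by exact: nneseries_ge0.
  (* A nonnegative term is at most the whole series; taking s-th roots bounds each term of the
     supremum uniformly in [k], for every s > 0. *)
  have uT k : (u k <= T)%E.
    apply: le_trans (nneseries_lim_ge k.+1 _) => //.
    by rewrite big_nat_recr//= leeDr// sume_ge0.
  rewrite mulrC EFinM -muleA muleC; apply: lee_wpmul2l.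
    by rewrite lee_fin invr_ge0 ltW.
  have phiT : ((r `^ (- lambda))%:E * phi r <= C%:E * T `^ s^-1)%E.
    have supT : (ereal_sup (range (fun k => (b ^+ k)%:E * psi (2 ^+ k * r)%R))
        <= (r `^ lambda)%:E * T `^ s^-1)%E.
      apply: ge_ereal_sup => _ [k _ <-].
      have : (u k `^ s^-1 <= T `^ s^-1)%E.
        by apply: le_poweR => //; rewrite invr_ge0 ltW.
      rewrite /u -poweRrM mulfV ?gt_eqF// poweRe1; last first.
        by rewrite !mule_ge0 ?lee_fin ?powR_ge0 ?exprn_ge0// ltW.
      move=> /(@lee_wpmul2l _ (r `^ lambda)%:E); rewrite lee_fin powR_ge0 => /(_ isT).
      by rewrite muleA -EFinM powRN mulfV ?gt_eqF ?powR_gt0// mul1e.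
    apply: (@le_trans _ _ ((r `^ (- lambda))%:E * (C%:E *
        ((r `^ lambda)%:E * T `^ s^-1)))%E).
      apply: lee_wpmul2l; first by rewrite lee_fin powR_ge0.
      apply: (le_trans (le_phi _ r0)); apply: lee_wpmul2l => //.
      by rewrite lee_fin ltW.
    by rewrite !muleA -!EFinM powRN mulrAC mulVf ?mul1r// gt_eqF// powR_gt0.
  apply: (@le_trans _ _ ((C%:E * T `^ s^-1) `^ s)%E).
    by apply: le_poweR => //; [exact: ltW|rewrite mule_ge0 ?lee_fin ?powR_ge0 ?phi0].
  rewrite poweRM ?lee_fin ?poweR_ge0 ?(ltW C0)// -poweRrM mulVf ?gt_eqF//.
  by rewrite poweRe1// poweR_EFin.
rewrite integral_nneseries//; last 2 first.
- by move=> k; apply: emeasurable_funM; [exact: measurable_cst|exact: mGk].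
- by move=> k r /=; rewrite in_itv/= andbT; exact: F0.
apply: le_trans (geometric_eseries_le d0 d1 (powR_ge0 C s) I0).
rewrite le_eqVlt; apply/orP; left; apply/eqP; apply: eq_eseriesr => k _.
have GkD r : `]0%R, +oo[%classic r -> (0 <= G (2 ^+ k * r)%R)%E.
  by rewrite /= in_itv/= andbT => r0; rewrite G0// mulr_gt0 ?exprn_gt0.
have w0 : 0 <= C `^ s * d ^+ k * 2 ^+ k.
  by rewrite !mulr_ge0 ?exprn_ge0 ?powR_ge0.
transitivity ((C `^ s * d ^+ k * 2 ^+ k)%:E *
    \int[lebesgue_measure]_(r in `]0%R, +oo[) G (2 ^+ k * r)%R)%E.
  exact: (ge0_integralZl_EFin lebesgue_measure (measurable_itv _) GkD (mGk k) w0).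
(* Dilation invariance of dr/r: the Jacobian 2^(-k) cancels the factor 2^k put into [F]. *)
rewrite (ge0_integral_scale _ mG G0) ?exprn_gt0//.
by rewrite muleA -EFinM mulfK// expf_neq0.
Qed.

End dyadic.

(** * Oscillation *)

Section oscillation.
Context {R : realType} {n : nat}.
Local Notation Rn := (euclidean R n).
Local Notation mu := (leb R n).
Implicit Types (f : Rn -> R) (x : Rn) (p r c b lambda : R) (q : \bar R).

Definition morrey_sup p f r : \bar R :=
  ereal_sup [set Lp_on p (eball x r) f | x in setT].

Definition campanato_sup p f r : \bar R :=
  ereal_sup [set Lp_on p (eball x r) (fun y => f y - avg r f x) | x in setT].

Definition osc p f r : \bar R :=
  ereal_sup [set ereal_inf [set Lp_on p (eball x r) (fun y => f y - c) | c in setT]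
            | x in setT].

Lemma morrey_normE p q lambda f :
  morrey_norm p q lambda f = radial_norm lambda q (morrey_sup p f).
Proof. by rewrite /morrey_norm. Qed.

Lemma campanato_normE p q lambda f : campanato_norm p q lambda f =
  (radial_norm lambda q (campanato_sup p f) + morrey_sup p f 1)%E.
Proof. by rewrite /campanato_norm /campanato_seminorm. Qed.

Lemma Lp_on_ge0 p (B : set Rn) (g : Rn -> R) : (0 <= Lp_on p B g)%E.
Proof. exact: poweR_ge0. Qed.

Lemma ereal_sup_Rn_ge0 (F : Rn -> \bar R) : (forall x, 0 <= F x)%E ->
  (0 <= ereal_sup [set F x | x in setT])%E.
Proof.
(* The origin is a competitor; a supremum over the empty set would be [-oo]. *)
move=> F0; apply: le_trans (F0 [tuple of nseq n 0]) _.
by apply: ereal_sup_ubound; eexists.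
Qed.

Lemma morrey_sup_ge0 p f r : (0 <= morrey_sup p f r)%E.
Proof. by apply: ereal_sup_Rn_ge0 => x; exact: Lp_on_ge0. Qed.

Lemma campanato_sup_ge0 p f r : (0 <= campanato_sup p f r)%E.
Proof. by apply: ereal_sup_Rn_ge0 => x; exact: Lp_on_ge0. Qed.

Lemma osc_ge0 p f r : (0 <= osc p f r)%E.
Proof.
apply: ereal_sup_Rn_ge0 => x; apply: le_ereal_inf_tmp => _ [c _ <-].
exact: Lp_on_ge0.
Qed.

Lemma le_Lp_on_eball p x r r' f : 0 < p -> measurable_fun setT f -> r <= r' ->
  (Lp_on p (eball x r) f <= Lp_on p (eball x r') f)%E.
Proof.
move=> p0 mf rr'.
exact: (le_Lp_norm_on mu p0 (measurable_eball x r) (measurable_eball x r') mf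
  (subset_eball rr')).
Qed.

Lemma le_morrey_sup p f : 0 < p -> measurable_fun setT f ->
  {homo morrey_sup p f : r r' / r <= r' >-> (r <= r')%E}.
Proof.
move=> p0 mf r r' rr'; apply: ge_ereal_sup => _ [x _ <-].
apply: le_trans (le_Lp_on_eball x p0 mf rr') _.
by apply: ereal_sup_ubound; exists x.
Qed.

Lemma measurable_fun_subc f c : measurable_fun setT f ->
  measurable_fun setT (fun y => f y - c).
Proof. by move=> mf; exact: (measurable_funB mf (measurable_cst c)). Qed.

(** For a fixed constant the local norm grows with the ball, and infimum and supremum preserve this;
    averages would vary with the radius. *)
Lemma le_osc p f : 0 < p -> measurable_fun setT f ->
  {homo osc p f : r r' / r <= r' >-> (r <= r')%E}.
Proof.
move=> p0 mf r r' rr'; apply: ge_ereal_sup => _ [x _ <-].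
apply: (@le_trans _ _ (ereal_inf
    [set Lp_on p (eball x r') (fun y => f y - c) | c in setT])); last first.
  by apply: ereal_sup_ubound; exists x.
apply: le_ereal_inf_tmp => _ [c _ <-].
apply: le_trans (le_Lp_on_eball x p0 (measurable_fun_subc c mf) rr').
by apply: ereal_inf_lbound; exists c.
Qed.

Lemma osc_le_campanato_sup p f r : (osc p f r <= campanato_sup p f r)%E.
Proof.
apply: ge_ereal_sup => _ [x _ <-].
apply: (@le_trans _ _ (Lp_on p (eball x r) (fun y => f y - avg r f x))).
  by apply: ereal_inf_lbound; exists (avg r f x).
by apply: ereal_sup_ubound; exists x.
Qed.

Section fixed_ball.
Variables (f : Rn -> R) (p r : R) (x : Rn).
Hypotheses (lf : loc_integrable f) (p1 : 1 <= p) (r0 : 0 < r).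

Let integrable_eball : mu.-integrable (eball x r) (EFin \o f).
Proof.
have [mf fr] := lf; apply/integrableP; split; last exact: fr.
by apply/measurable_EFinP; exact: measurable_funS mf.
Qed.

Let leb_eball_gt0 : (0 < mu (eball x r))%E.
Proof.
have := fine_leb_eball_gt0 x r0; rewrite -lte_fin fineK//.
exact: leb_eball_fin_num.
Qed.

Lemma Lp_on_sub_avg_le c :
  (Lp_on p (eball x r) (fun y => f y - avg r f x)%R
    <= 2%:E * Lp_on p (eball x r) (fun y => f y - c)%R)%E.
Proof.
exact: (Lp_norm_on_sub_mean (measurable_eball x r) (leb_eball_fin_num x r0)
  leb_eball_gt0 lf.1 integrable_eball c p1).
Qed.

Lemma avg_sub_le c :
  (`|(avg r f x - c)%R|%:E * mu (eball x r) `^ p^-1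
    <= Lp_on p (eball x r) (fun y => f y - c)%R)%E.
Proof.
exact: (mean_on_sub_le (measurable_eball x r) (leb_eball_fin_num x r0)
  leb_eball_gt0 lf.1 integrable_eball c p1).
Qed.

Lemma Lp_on_le_avg :
  (Lp_on p (eball x r) f <= Lp_on p (eball x r) (fun y => f y - avg r f x)%R
    + `|avg r f x|%:E * mu (eball x r) `^ p^-1)%E.
Proof.
exact: (@Lp_norm_on_le_mean _ _ _ (leb R n) _ _ (measurable_eball x r) lf.1 _ p1).
Qed.

End fixed_ball.
End oscillation.

(** * Comparison of the local suprema at a given radius *)

Section comparison.
Context {R : realType} {n : nat}.
Local Notation Rn := (euclidean R n).
Local Notation mu := (leb R n).
Implicit Types (f : Rn -> R) (x : Rn) (p r c b : R).

(** Together with [osc_le_campanato_sup], this allows the monotone [osc] to replace [campanato_sup]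
    at the cost of a factor 2. *)
Lemma campanato_sup_le_osc p f r : loc_integrable f -> 1 <= p -> 0 < r ->
  (campanato_sup p f r <= 2%:E * osc p f r)%E.
Proof.
move=> lf p1 r0; apply: ge_ereal_sup => _ [x _ <-].
apply: (@le_trans _ _ (2%:E * ereal_inf
    [set Lp_on p (eball x r) (fun y => f y - c)%R | c in setT])%E); last first.
  apply: lee_wpmul2l; first by rewrite lee_fin.
  by apply: ereal_sup_ubound; exists x.
rewrite -lee_pdivrMl//; apply: le_ereal_inf_tmp => _ [c _ <-].
by rewrite lee_pdivrMl//; exact: Lp_on_sub_avg_le.
Qed.

Lemma campanato_sup_le_morrey_sup p f r : loc_integrable f -> 1 <= p -> 0 < r ->
  (campanato_sup p f r <= 2%:E * morrey_sup p f r)%E.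
Proof.
move=> lf p1 r0; apply: ge_ereal_sup => _ [x _ <-].
(* The average is compared with the constant 0. *)
apply: le_trans (Lp_on_sub_avg_le x lf p1 r0 0) _.
apply: lee_wpmul2l; first by rewrite lee_fin.
apply: ereal_sup_ubound; exists x; first by [].
by apply: (congr1 (Lp_on p (eball x r))); apply/funext => y; rewrite subr0.
Qed.

Lemma powR_fine_leb_eball_pow2 p x r (k : nat) : 1 <= p -> 0 < r ->
  (n.+1%:R ^- n) `^ p^-1 * ((2 ^+ n) `^ p^-1) ^+ k *
    fine (mu (eball x r)) `^ p^-1
  <= fine (mu (eball x (2 ^+ k * r))) `^ p^-1.
Proof.
move=> p1 r0; have v0 := fine_leb_eball_gt0 x r0.
have kr0 : 0 < 2 ^+ k * r by rewrite mulr_gt0 ?exprn_gt0.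
have := fine_leb_eball_pow2 x k r0.
move: (fine_leb_eball_gt0 x kr0) v0; move: (fine _) (fine _) => v w w0 v0 vw.
have pi0 : 0 <= p^-1 by rewrite invr_ge0 (le_trans _ p1).
have E0 : 0 <= (2 ^+ n) ^+ k :> R by rewrite !exprn_ge0.
have N0 : 0 <= n.+1%:R ^- n :> R by rewrite invr_ge0 exprn_ge0.
have <- : (n.+1%:R ^- n * (2 ^+ n) ^+ k * v) `^ p^-1 =
    (n.+1%:R ^- n) `^ p^-1 * ((2 ^+ n) `^ p^-1) ^+ k * v `^ p^-1.
  rewrite (powRM _ (mulr_ge0 N0 E0) (ltW v0)) (powRM _ N0 E0).
  by rewrite powR_exprn// exprn_ge0.
apply: ge0_ler_powR => //; rewrite nnegrE; last exact: ltW.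
by rewrite mulr_ge0 ?mulr_ge0// ltW.
Qed.

(** Oscillations may grow like b^(-k), but |B|^(1/p) grows like 2^(kn/p); the condition on [b] makes
    the increments of the averages decay geometrically. *)
Lemma avg_telescope_le f p x r e b : loc_integrable f -> 1 <= p -> 0 < r ->
  avg s f x @[s --> +oo] --> (0 : R) ->
  0 <= e -> 0 < b -> 1 < b * (2 ^+ n) `^ p^-1 ->
  (forall k, Lp_on p (eball x (2 ^+ k * r))
     (fun y => f y - avg (2 ^+ k * r) f x)%R <= (e / b ^+ k)%:E)%E ->
  `|avg r f x| * fine (mu (eball x r)) `^ p^-1 <=
  e / ((n.+1%:R ^- n) `^ p^-1 * b) / (1 - (b * (2 ^+ n) `^ p^-1)^-1).
Proof.
move=> lf p1 r0 lim0 e0 b0 bT He.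
have p0 : 0 < p by apply: lt_le_trans p1.
set K := (n.+1%:R ^- n) `^ p^-1; set T := (2 ^+ n) `^ p^-1 in bT *.
have K0 : 0 < K by rewrite powR_gt0// invr_gt0 exprn_gt0.
have T0 : 0 < T by rewrite powR_gt0// exprn_gt0.
set w := fine _ `^ _.
have w0 : 0 < w by rewrite powR_gt0// fine_leb_eball_gt0.
pose A k := avg (2 ^+ k * r) f x.
have A0 : A 0%N = avg r f x by rewrite /A expr0 mul1r.
have kr0 k : 0 < 2 ^+ k * r by rewrite mulr_gt0 ?exprn_gt0.
set a := (b * T)^-1.
have a0 : 0 < a by rewrite invr_gt0 mulr_gt0.
have a1 : a < 1 by rewrite invf_lt1// mulr_gt0.
(* The extra [b] comes from bounding the k-th increment by the oscillation at scale k + 1. *)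
set M := e / (K * b).
have M0 : 0 <= M by rewrite divr_ge0// mulr_ge0 ?ltW.
(* Take [A k.+1] as the constant on the k-th ball, enlarge to the next ball to use the hypothesis,
   and bound the volume of the k-th ball below by that of the first. *)
have step k : `|A k - A k.+1| * w <= M * a ^+ k.
  have v0 := fine_leb_eball_gt0 x (kr0 k).
  have : (`|A k - A k.+1|%:E * mu (eball x (2 ^+ k * r)) `^ p^-1 <=
      (e / b ^+ k.+1)%:E)%E.
    apply: le_trans (avg_sub_le x lf p1 (kr0 k) (A k.+1)) _.
    apply: le_trans (He k.+1).
    have le_kr : 2 ^+ k * r <= 2 ^+ k.+1 * r.
      by rewrite ler_pM2r// exprS ler_peMl ?exprn_ge0// ler1n.
    exact: (le_Lp_on_eball x p0 (measurable_fun_subc (A k.+1) lf.1) le_kr).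
  rewrite -[mu _]fineK ?leb_eball_fin_num// poweR_EFin -EFinM lee_fin => H.
  have H2 := powR_fine_leb_eball_pow2 x k p1 r0.
  have KT0 : 0 < K * T ^+ k by rewrite mulr_gt0 ?exprn_gt0.
  rewrite -(ler_pM2l KT0).
  apply: le_trans (_ : `|A k - A k.+1| * (K * T ^+ k * w) <= _).
    by rewrite mulrCA.
  apply: le_trans (ler_wpM2l _ H2) _ => //.
  apply: le_trans H _; rewrite le_eqVlt; apply/orP; left; apply/eqP.
  rewrite /M /a exprVn exprMn exprS; field.
  by rewrite !gt_eqF ?exprn_gt0.
have tele m : `|A 0%N - A m| * w <= M / (1 - a).
  apply: (@le_trans _ _ (series (geometric M a) m)); last first.
    by apply: geometric_le_lim => //; rewrite gtr0_norm.
  elim: m => [|m ih].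
    by rewrite subrr normr0 mul0r /series/= big_geq.
  rewrite seriesSr.
  apply: (@le_trans _ _ ((`|A 0%N - A m| + `|A m - A m.+1|) * w)).
    by rewrite ler_wpM2r ?(ltW w0)// ler_distD.
  by rewrite mulrDl lerD//; exact: step.
(* The telescoped bound is uniform in [m], so it suffices to choose a dyadic scale at which the
   average is below [eps / w]. *)
rewrite -A0; apply/ler_addgt0Pr => eps eps0.
have epsw : 0 < eps / w by rewrite divr_gt0.
have /cvgr0Pnorm_lt /(_ _ epsw) [N [_ HN]] := lim0.
have [m Hm] : exists m, N < 2 ^+ m * r.
  exists (Num.bound `|N / r|); rewrite -ltr_pdivrMr//.
  apply: (le_lt_trans (ler_norm _)).
  apply: (lt_le_trans (archi_boundP (normr_ge0 _))).
  by rewrite -natrX ler_nat ltnW// ltn_expl.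
have := HN _ Hm; rewrite -/(A m) ltr_pdivlMr// => HAm.
apply: (@le_trans _ _ ((`|A 0%N - A m| + `|A m|) * w)).
  rewrite ler_wpM2r ?(ltW w0)// -[X in `|X| <= _](subrK (A m)).
  exact: ler_normD.
by rewrite mulrDl lerD// ltW.
Qed.

Lemma morrey_sup_le_osc p b : 1 <= p -> 0 < b -> 1 < b * (2 ^+ n) `^ p^-1 ->
  exists2 C, 0 < C & forall f, loc_integrable f ->
    (forall x, avg r f x @[r --> +oo] --> (0 : R)) ->
    forall r, 0 < r -> (morrey_sup p f r <=
      C%:E * ereal_sup (range (fun k => (b ^+ k)%:E * osc p f (2 ^+ k * r)%R)))%E.
Proof.
move=> p1 b0 bT.
set K := (n.+1%:R ^- n) `^ p^-1 * b.
set a := (b * (2 ^+ n) `^ p^-1)^-1.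
have K0 : 0 < K by rewrite mulr_gt0 ?powR_gt0// invr_gt0 exprn_gt0.
have a1 : a < 1 by rewrite invf_lt1// (lt_trans _ bT).
(* The first 2 accounts for f minus its average on the initial ball, the other summand for that
   average; here [K] already includes [b]. *)
exists (2 + 2 / K / (1 - a)).
  by rewrite addr_gt0// !divr_gt0// subr_gt0.
have C0 : 0 < 2 + 2 / K / (1 - a).
  by rewrite addr_gt0// !divr_gt0// subr_gt0.
move=> f lf lim0 r r0; set S := ereal_sup _.
have leS k : ((b ^+ k)%:E * osc p f (2 ^+ k * r)%R <= S)%E.
  by apply: ereal_sup_ubound; exists k.
have S0 : (0 <= S)%E.
  by apply: le_trans (leS 0%N); rewrite mule_ge0 ?osc_ge0// lee_fin exprn_ge0 ?ltW.
(* An infinite supremum makes the bound trivial; otherwise the telescoping takes place in the reals,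
   with e equal to twice the supremum. *)
have [Soo|] := eqVneq S +oo%E; first by rewrite Soo gt0_muley ?lte_fin// leey.
rewrite -ltey -ge0_fin_numE// => S_fin.
set s := fine S; have SE : S = s%:E by rewrite fineK.
have s0 : 0 <= s by rewrite fine_ge0.
apply: ge_ereal_sup => _ [x _ <-].
have kr0 k : 0 < 2 ^+ k * r by rewrite mulr_gt0 ?exprn_gt0.
have He k : (Lp_on p (eball x (2 ^+ k * r))
     (fun y => f y - avg (2 ^+ k * r) f x)%R <= (2 * s / b ^+ k)%:E)%E.
  apply: (@le_trans _ _ (campanato_sup p f (2 ^+ k * r))).
    by apply: ereal_sup_ubound; exists x.
  apply: le_trans (campanato_sup_le_osc lf p1 (kr0 k)) _.
  rewrite -mulrA EFinM; apply: lee_wpmul2l; first by rewrite lee_fin.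
  by rewrite (mulrC s) EFinM -SE lee_pdivlMl ?exprn_gt0.
have H0 := He 0%N; rewrite expr0 mul1r divr1 in H0.
have := avg_telescope_le lf p1 r0 (lim0 x) (mulr_ge0 (ler0n _ 2) s0) b0 bT He.
rewrite -/K -/a => HA.
apply: le_trans (Lp_on_le_avg r x lf p1) _.
rewrite -[mu _]fineK ?leb_eball_fin_num// poweR_EFin -EFinM SE -EFinM.
apply: (@le_trans _ _ ((2 * s)%:E + (2 * s / K / (1 - a))%:E)%E).
  by apply: leeD; [exact: H0|rewrite lee_fin].
rewrite -EFinD lee_fin le_eqVlt; apply/orP; left; apply/eqP; ring.
Qed.

End comparison.

Theorem proposition3p9 (R : realType) (n : nat) (p lambda : R) (q : \bar R)
    (hn : (1 <= n)%N) (hp : 1 <= p) (hl0 : 0 < lambda)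
    (hl : lambda < n%:R / p) (hq : (0 < q)%E) :
  exists c C : R, [/\ 0 < c, 0 < C &
    forall f : euclidean R n -> R,
      loc_integrable f ->
      (forall x : euclidean R n, avg r f x @[r --> +oo] --> (0 : R)) ->
      (c%:E * morrey_norm p q lambda f <= campanato_norm p q lambda f)%E /\
      (campanato_norm p q lambda f <= C%:E * morrey_norm p q lambda f)%E].
Proof.
have p0 : 0 < p := lt_le_trans ltr01 hp.
(* The geometric mean of 2^(-n/p) and 2^(-lambda): then b 2^(n/p) = 2^e > 1 for the telescoping and
   b 2^lambda = 2^(-e) < 1 for the dyadic series. *)
pose b : R := 2 `^ (- ((n%:R / p + lambda) / 2)).
have b0 : 0 < b by rewrite powR_gt0.
pose e := (n%:R / p - lambda) / 2.
have e0 : 0 < e by rewrite divr_gt0// subr_gt0.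
have e1 : 1 < 2 `^ e.
  by have := gt0_ltr_powR e0 _ _ (ltr1n R 2); rewrite powR1 !nnegrE; apply.
have bT : 1 < b * (2 ^+ n) `^ p^-1.
  rewrite /b -powR_mulrn// -powRrM -powRD ?pnatr_eq0 ?implybT//.
  suff -> : - ((n%:R / p + lambda) / 2) + n%:R / p = e by [].
  by rewrite /e; field; rewrite gt_eqF.
have bl : b * 2 `^ lambda < 1.
  rewrite /b -powRD ?pnatr_eq0 ?implybT//.
  suff -> : - ((n%:R / p + lambda) / 2) + lambda = - e.
    by rewrite powRN invf_lt1// powR_gt0.
  by rewrite /e; field; rewrite gt_eqF.
have [C1 C10 morrey_osc] := @morrey_sup_le_osc R n p b hp b0 bT.
have [D1 D10 dyadic1] := radial_norm_dyadic hq b0 bl C10.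
have [D2 D20 dyadic2] := radial_norm_dyadic hq b0 bl (ltr0n R 2).
have [C3 C30 at1] := radial_norm_ge1 hl0 hq.
exists D1^-1, (D2 + C3); split; rewrite ?invr_gt0 ?addr_gt0// => f lf lim0.
have [mf _] := lf.
rewrite campanato_normE morrey_normE; split.
  rewrite lee_pdivrMl//.
  apply: (le_trans (dyadic1 _ (osc p f) (le_osc p0 mf) (osc_ge0 p f) _ _)).
  - by move=> r _; exact: morrey_sup_ge0.
  - exact: morrey_osc.
  apply: lee_wpmul2l; first by rewrite lee_fin ltW.
  apply: (@le_trans _ _ (radial_norm lambda q (campanato_sup p f))).
    apply: le_radial_norm => // r _; first exact: osc_ge0.
    exact: osc_le_campanato_sup.
  by rewrite leeDl// morrey_sup_ge0.
rewrite EFinD ge0_muleDl ?lee_fin ?(ltW D20) ?(ltW C30)//; apply: leeD.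
  (* Only the term k = 0 of the supremum is used: the dyadic bound merely moves the factor 2 out of
     the radial norm. *)
  apply: dyadic2.
  - exact: le_morrey_sup.
  - exact: morrey_sup_ge0.
  - by move=> r _; exact: campanato_sup_ge0.
  move=> r r0; apply: le_trans (campanato_sup_le_morrey_sup lf hp r0) _.
  apply: lee_wpmul2l; first by rewrite lee_fin.
  by apply: ereal_sup_ubound; exists 0%N; rewrite // !expr0 mul1e mul1r.
by apply: at1; [exact: le_morrey_sup|exact: morrey_sup_ge0].
Qed.
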